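(* (1) For every $\alpha\in(0,1]$, $\mathrm{ES}_\alpha=\min\{\rho:L^1\to\overline{\mathbb{R}}\mid\rho\ge\mathrm{VaR}_\alpha\text{ and }\rho\text{ is quasi-convex and law invariant}\}$. (2) For every $\alpha\in(0,1)$, $\mathrm{ES}_\alpha=\min\{\rho:L^1\to\overline{\mathbb{R}}\mid\rho\ge\mathrm{VaR}^+_\alpha\text{ and }\rho\text{ is quasi-convex and law invariant}\}$. (3) For every $\alpha\in[0,1)$, $\mathrm{ES}_\alpha=\min\{\rho:\underline{L}^1\to\overline{\mathbb{R}}\mid\rho\ge\mathrm{VaR}^+_\alpha\text{ and }\rho\text{ is quasi-convex and law invariant}\}$ (with $\mathrm{ES}_\alpha$ restricted to $\underline{L}^1$). Here ''min'' means that $\mathrm{ES}_\alpha$ belongs to the set and is pointwise $\le$ every element of it.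
   Context: $(\Omega,\mathcal F,\mathbb P)$ is an atomless probability space, $L^0$ all random variables, $L^1$ integrable ones, $\underline{L}^1$ the elements of $L^1$ that are essentially bounded from below; $\overline{\mathbb{R}}=[-\infty,\infty]$. For $\alpha\in[0,1]$, $X\in L^0$: $\mathrm{VaR}_\alpha(X)=\inf\{x\in\mathbb{R}:\mathbb P(X\le x)\ge\alpha\}$, $\mathrm{VaR}^+_\alpha(X)=\inf\{x\in\mathbb{R}:\mathbb P(X\le x)>\alpha\}$ ($\inf\mathbb{R}=-\infty$, $\inf\emptyset=\infty$). For $X\in L^1$: $\mathrm{ES}_\alpha(X)=\frac{1}{1-\alpha}\int_\alpha^1\mathrm{VaR}_\beta(X)\,\mathrm d\beta$ for $\alpha\in[0,1)$, $\mathrm{ES}_1(X)=\mathrm{VaR}_1(X)$ (values in $(-\infty,\infty]$). A map $\rho$ on a set $\mathcal X$ of random variables is quasi-convex if $\rho(\gamma X+(1-\gamma)Y)\le\max\{\rho(X),\rho(Y)\}$ for all $X,Y\in\mathcal X$, $\gamma\in[0,1]$, and law invariant if $\rho(X)=\rho(Y)$ for equally distributed $X,Y$. $\rho\ge\widetilde\rho$ means pointwise inequality on the common domain. *)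

(* Defs.v *)
From HB Require Import structures.
From mathcomp Require Import all_boot all_order all_algebra.
From mathcomp Require Import all_classical all_reals all_analysis.
Set Implicit Arguments. Unset Strict Implicit. Unset Printing Implicit Defensive.
Import Order.TTheory GRing.Theory Num.Theory.
Local Open Scope classical_set_scope.
Local Open Scope ring_scope.
Local Open Scope ereal_scope.

Section Defs.
Context {R : realType} {d : measure_display} {T : measurableType d}.
Variable P : probability T R.

Definition atomless : Prop :=
  forall A : set T, measurable A -> 0 < P A ->
    exists B : set T, [/\ measurable B, B `<=` A, 0 < P B & P B < P A].

Definition L0 : set (T -> R) := [set X | measurable_fun setT X].

Definition L1 : set (T -> R) :=
  [set X | measurable_fun setT X /\ P.-integrable setT (EFin \o X)].

Definition L1b : set (T -> R) :=
  [set X | L1 X /\ exists c : R, P [set w | X w < c]%R = 0].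

Definition same_law (X Y : T -> R) : Prop :=
  forall B : set R, measurable B -> P (X @^-1` B) = P (Y @^-1` B).

(* VaR_alpha(X) = inf {x in R : P(X <= x) >= alpha}, in \bar R
   (inf R = -oo, inf emptyset = +oo). *)
Definition VaR (a : R) (X : T -> R) : \bar R :=
  ereal_inf [set x%:E | x in [set x : R | a%:E <= P [set w | X w <= x]%R]].

Definition VaRp (a : R) (X : T -> R) : \bar R :=
  ereal_inf [set x%:E | x in [set x : R | a%:E < P [set w | X w <= x]%R]].

Definition ES (a : R) (X : T -> R) : \bar R :=
  if (a < 1)%R then
    ((1 - a)^-1)%:E * \int[lebesgue_measure]_(b in `]a, 1%R[) VaR b X
  else VaR 1 X.

Definition quasi_convex_on (D : set (T -> R)) (rho : (T -> R) -> \bar R) :=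
  forall X Y, D X -> D Y -> forall g : R, (0 <= g <= 1)%R ->
    rho (fun w => g * X w + (1 - g) * Y w)%R <= maxe (rho X) (rho Y).

Definition law_invariant_on (D : set (T -> R)) (rho : (T -> R) -> \bar R) :=
  forall X Y, D X -> D Y -> same_law X Y -> rho X = rho Y.

Definition dominates_on (D : set (T -> R)) (rho sigma : (T -> R) -> \bar R) :=
  forall X, D X -> sigma X <= rho X.

Definition admissible (D : set (T -> R)) (V : (T -> R) -> \bar R)
  (rho : (T -> R) -> \bar R) :=
  [/\ dominates_on D rho V, quasi_convex_on D rho & law_invariant_on D rho].

Definition is_min_admissible (D : set (T -> R)) (V : (T -> R) -> \bar R)
  (rho0 : (T -> R) -> \bar R) :=
  admissible D V rho0 /\
  forall rho, admissible D V rho -> forall X, D X -> rho0 X <= rho X.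

End Defs.

(* Main.v *)
(* With q(b) = VaR_b(X), (1 - a) ES_a(X) is the integral of q over ]a, 1[, and
   q(U) has the law of X whenever U is uniform; atomlessness provides such a U.
   - ES is convex because (1 - a) ES_a(X) is the minimum over k of
     (1 - a) k + E (X - k)^+ (Rockafellar-Uryasev), which is attained at any k
     separating q on ]0, a] from q on [a, 1[.
   - Minimality for VaR^+_a: rotating U inside [a, 1[ by (1 - a) i / n, i < n,
     gives n copies of X whose mean is, on {U >= a}, bounded below by a lower
     Riemann sum of q.  Since P(U < a) = a, quasi-convexity and law invariance
     yield rho(X) >= rho(mean) >= VaR^+_a(mean) >= Riemann sum, which tends to
     ES_a(X).  No continuity of rho is used.
   - VaR_a >= VaR^+_b for b < a, so minimality for VaR_a follows by b -> a. *)
From HB Require Import structures.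
Require Import Defs.
From mathcomp Require Import all_boot all_order all_algebra.
From mathcomp Require Import all_classical all_reals all_analysis.
From mathcomp Require Import measurable_realfun zify ring lra.
Set Implicit Arguments. Unset Strict Implicit. Unset Printing Implicit Defensive.
Import Order.TTheory GRing.Theory Num.Theory.
Import numFieldNormedType.Exports.
Local Open Scope classical_set_scope.
Local Open Scope ring_scope.

(** * Laws and distribution functions *)

(** One device serves both convexity and minimality: a level separating the quantiles below [a] from
    those above it ([threshold]). For convexity it is the minimizer in the Rockafellar-Uryasev
    formula; for minimality it bounds the quantiles on the first cell of the Riemann sum. When
    [a > 0] the quantile at [a] is such a level; when [a = 0] a lower bound of all quantiles takes
    its place, and this is where boundedness from below enters. The rotation fixes [U] below [a]
    because an event of mass exactly [a] is what the strict inequality in VaR^+_a ignores. The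
    identity X = q(U) is never sought: [U] is an arbitrary uniform variable on the space, and law
    invariance of [rho] ties [X] to its rearranged copies. The means of these copies are only
    bounded below, on the event [a <= U], by a constant that does not depend on the sample point. *)

Section same_cdf.
Context {R : realType}.
Local Open Scope ereal_scope.

(** Rays form a pi-system, generate the half-open intervals as differences, and exhaust the line
    with finite mass. *)
Lemma measure_eq_of_rays (m1 m2 : {measure set (measurableTypeR R) -> \bar R}) :
  m1 setT < +oo -> (forall x : R, m1 `]-oo, x]%classic = m2 `]-oo, x]%classic) ->
  forall B : set R, measurable B -> m1 B = m2 B.
Proof.
move=> m1oo m12; pose G := [set `]-oo, x]%classic | x in [set: R]].
have fin_ray (r : R) : m1 `]-oo, r]%classic < +oo.
  by apply: le_lt_trans m1oo; rewrite le_measure ?inE.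
apply: (@measure_unique _ R (measurableTypeR R) G
  (fun n : nat => `]-oo, n%:R]%classic) _ _ _ _ m1 m2).
- rewrite /measurable /= eqEsubset; split => A.
    apply: smallest_sub; first exact: smallest_sigma_algebra.
    move=> _ [[a b] _ <-].
    have -> : `]a, b]%classic = `]-oo, b]%classic `\` `]-oo, a]%classic.
      rewrite eqEsubset; split => x /=; rewrite !in_itv /=.
        by move=> /andP[ax ->]; split => //; rewrite leNgt ax.
      by move=> [-> /negP]; rewrite -ltNge => ->.
    by apply: (@measurableD _ (g_sigma_algebraType G)); apply: sub_sigma_algebra;
      [exists b | exists a].
  apply: smallest_sub; first exact: smallest_sigma_algebra.
  move=> _ [x _ <-].
  exact: (measurable_itv `]-oo, x]).
- move=> _ _ [x _ <-] [y _ <-]; exists (Order.min x y) => //.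
  rewrite eqEsubset; split => z /=; rewrite !in_itv /= le_min.
    by move=> /andP[].
  by move=> [-> ->].
- by move=> n; exists n%:R.
- rewrite -subTset => x _; exists (Num.truncn `|x|).+1 => //=.
  rewrite in_itv /= (le_trans (ler_norm x))// ltW//.
  by rewrite truncnS_gt.
- by move=> _ [x _ <-].
- by move=> n.
Qed.

(** Two probability spaces appear because [quantile P X] is later viewed as a random variable on the
    unit interval, while [X] lives on [T]. *)
Lemma same_cdf_law d1 d2 (S : measurableType d1) (T : measurableType d2)
    (Q : probability S R) (P : probability T R) (Y : S -> R) (X : T -> R) :
  measurable_fun setT Y -> measurable_fun setT X ->
  (forall x, Q [set w | Y w <= x]%R = P [set w | X w <= x]%R) ->
  forall B : set R, measurable B -> Q (Y @^-1` B) = P (X @^-1` B).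
Proof.
move=> mY mX YX B mB.
have mY' : measurable_fun setT (Y : S -> measurableTypeR R) by [].
have mX' : measurable_fun setT (X : T -> measurableTypeR R) by [].
pose Y' : {mfun S >-> measurableTypeR R} :=
  HB.pack (Y : S -> measurableTypeR R) (isMeasurableFun.Build _ _ _ _ _ mY').
pose X' : {mfun T >-> measurableTypeR R} :=
  HB.pack (X : T -> measurableTypeR R) (isMeasurableFun.Build _ _ _ _ _ mX').
apply: (measure_eq_of_rays (m1 := distribution Q Y')
  (m2 := distribution P X')) => //.
  rewrite [ltLHS](_ : _ = 1) ?ltry//.
  exact: (@probability_setT _ _ _ (distribution Q Y')).
Qed.

End same_cdf.

(** * Quantile functions as real functions *)

Section quantile.
Context {R : realType} {d : measure_display} {T : measurableType d}.
Variable P : probability T R.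

Definition prob_le (X : T -> R) (x : R) : R := fine (P [set w | X w <= x]).

(** [VaR] is [-oo] at level 0 and may be [+oo] at level 1. The value 0 outside the open unit
    interval gives a total real function that can be integrated over the whole line. *)
Definition quantile (X : T -> R) : R -> R :=
  (fun b => fine (VaR P b X)) \_ `]0, 1[.

Variables (X : T -> R) (mX : measurable_fun setT X).

Lemma measurable_le_set (x : R) : measurable [set w | X w <= x].
Proof.
rewrite (_ : mkset _ = X @^-1` `]-oo, x]%classic).
  by rewrite -[X in measurable X]setTI; exact: mX.
by apply/seteqP; split => w /=; rewrite in_itv.
Qed.

Lemma measurable_lt_set (x : R) : measurable [set w | X w < x].
Proof.
rewrite (_ : mkset _ = X @^-1` `]-oo, x[%classic).
  by rewrite -[X in measurable X]setTI; exact: mX.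
by apply/seteqP; split => w /=; rewrite in_itv.
Qed.

Lemma prob_leE (x : R) : P [set w | X w <= x] = (prob_le X x)%:E.
Proof. by rewrite fineK// fin_num_measure//; exact: measurable_le_set. Qed.

Lemma prob_le_homo (x y : R) : x <= y -> prob_le X x <= prob_le X y.
Proof.
move=> xy; rewrite -lee_fin -!prob_leE le_measure ?inE//;
  try exact: measurable_le_set.
by move=> w /= /le_trans; apply.
Qed.

Lemma prob_le_ge0 (x : R) : 0 <= prob_le X x.
Proof. exact: fine_ge0. Qed.

Lemma prob_le_le1 (x : R) : prob_le X x <= 1.
Proof.
by rewrite -lee_fin -prob_leE probability_le1//; exact: measurable_le_set.
Qed.

Let X' : {mfun T >-> R} := HB.pack X (isMeasurableFun.Build _ _ _ _ X mX).

Let prob_le_cdf : prob_le X = fine \o @cdf _ _ _ P X'.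
Proof. by []. Qed.

Lemma prob_le_gt (b : R) : b < 1 -> exists x, b < prob_le X x.
Proof.
move=> b1.
have /cvgr_gt /(_ _ b1) bF : prob_le X @ +oo --> (1 : R).
  by rewrite prob_le_cdf; apply: fine_cvg; exact: cvg_cdfy1.
near (pinfty_nbhs R) => x; exists x; near: x; exact: bF.
Unshelve. all: by end_near. Qed.

Lemma prob_le_lt (b : R) : 0 < b -> exists x, prob_le X x < b.
Proof.
move=> b0.
have /cvgr_lt /(_ _ b0) bF : prob_le X @ -oo --> (0 : R).
  by rewrite prob_le_cdf; apply: fine_cvg; exact: cvg_cdfNy0.
near (ninfty_nbhs R) => x; exists x; near: x; exact: bF.
Unshelve. all: by end_near. Qed.

Lemma prob_le_right_closed (b x : R) :
  (forall y, x < y -> b <= prob_le X y) -> b <= prob_le X x.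
Proof.
move=> bF; rewrite leNgt; apply/negP => Fxb.
have /cvgr_lt /(_ _ Fxb) Fb : prob_le X y @[y --> x^'+] --> prob_le X x.
  rewrite prob_le_cdf; apply: fine_cvg => /=.
  have : @cdf _ _ _ P X' @ x^'+ --> @cdf _ _ _ P X' x.
    exact: cdf_right_continuous.
  by rewrite fineK//; exact: fin_num_measure.
near x^'+ => y.
have : prob_le X y < b by near: y; exact: Fb.
by rewrite ltNge bF.
Unshelve. all: by end_near. Qed.

Lemma VaR_quantile (b : R) : 0 < b < 1 -> VaR P b X = (quantile X b)%:E.
Proof.
move=> b01; rewrite /quantile patchE ifT ?inE//= ?in_itv//.
rewrite fineK// /VaR.
have [x1 bx1] := @prob_le_gt b ltac:(by case/andP: b01).
have [x0 bx0] := @prob_le_lt b ltac:(by case/andP: b01).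
rewrite ereal_inf_EFin//.
- exists x0 => x /=; rewrite prob_leE lee_fin => bx.
  rewrite leNgt; apply/negP => /ltW /prob_le_homo.
  by rewrite leNgt (lt_le_trans bx0).
- by exists x1 => /=; rewrite prob_leE lee_fin ltW.
Qed.

(** Galois connection with the distribution function, the source of monotonicity and of the law of
    the quantile. Left to right, it says that the infimum is attained, by right continuity. *)
Lemma quantile_le (b x : R) : 0 < b < 1 ->
  (quantile X b <= x) = (b <= prob_le X x).
Proof.
move=> b01; apply/idP/idP => [qx|bF].
  apply: prob_le_right_closed => y xy.
  have : (VaR P b X < y%:E)%E by rewrite VaR_quantile// lte_fin (le_lt_trans qx).
  move=> /ereal_inf_lt[_ [z /= bz <-]]; rewrite lte_fin => zy.
  by rewrite -lee_fin (le_trans bz)// prob_leE lee_fin prob_le_homo// ltW.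
rewrite -lee_fin -VaR_quantile//; apply: ereal_inf_lbound.
by exists x => //=; rewrite prob_leE lee_fin.
Qed.

Lemma quantile_homo (a b : R) : 0 < a -> a <= b -> b < 1 ->
  quantile X a <= quantile X b.
Proof.
move=> a0 ab b1.
rewrite quantile_le ?a0 ?(le_lt_trans ab)//.
by rewrite (le_trans ab)// -quantile_le ?b1 ?(lt_le_trans a0).
Qed.

Lemma measurable_quantile : measurable_fun setT (quantile X).
Proof.
apply/(@measurable_restrictT _ _ R R `]0, 1[%classic) => //.
apply: (@eq_measurable_fun _ _ _ _ _ (quantile X)) => [x x01|].
  by rewrite /quantile patchE x01.
apply: (measurability (@RGenCInfty.G R)) => [|/= _ [_] [r] -> <-].
  exact: RGenCInfty.measurableE.
(* By monotonicity the preimage of a ray within the open unit interval is order-convex. *)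
apply: is_interval_measurable => s t /= [].
rewrite !in_itv/= !andbT => /andP[s0 s1] qs [/andP[t0 t1] qt] u /andP[su ut].
rewrite !in_itv /= andbT (lt_le_trans s0 su) (le_lt_trans ut t1); split => //.
by rewrite (le_trans qs)// quantile_homo// (le_lt_trans ut).
Qed.

End quantile.

(** * Uniform variables and the quantile transform *)

Section uniform.
Context {R : realType} {d : measure_display} {S : measurableType d}.
Variable Q : probability S R.

Definition is_uniform (U : S -> R) :=
  measurable_fun setT U /\
  forall y, 0 <= y <= 1 -> Q [set w | U w <= y] = y%:E.

Variables (U : S -> R) (unifU : is_uniform U).

Let mU : measurable_fun setT U. Proof. by case: unifU. Qed.

Lemma uniform_lt (y : R) : 0 <= y <= 1 -> Q [set w | U w < y] = y%:E.
Proof.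
move=> y01; apply/eqP; rewrite eq_le; apply/andP; split.
  rewrite -(unifU.2 _ y01) le_measure ?inE//.
  - exact: measurable_lt_set.
  - exact: measurable_le_set.
  - by move=> w /=; exact: ltW.
apply/lee_addgt0Pr => e e0; rewrite -leeBlDr// -EFinB.
have [ye|ye] := leP y e.
  by rewrite (@le_trans _ _ 0%E)// lee_fin subr_le0.
rewrite -(unifU.2 (y - e)); last by lra.
rewrite le_measure ?inE//.
- exact: measurable_le_set.
- exact: measurable_lt_set.
- by move=> w /= /le_lt_trans; apply; lra.
Qed.

Lemma uniform_ge (y : R) : 0 <= y <= 1 -> Q [set w | y <= U w] = (1 - y)%:E.
Proof.
move=> y01; have -> : [set w | y <= U w] = ~` [set w | U w < y].
  by apply/seteqP; split => w /=; rewrite leNgt => /negP.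
by rewrite probability_setC ?uniform_lt//; exact: measurable_lt_set.
Qed.

(** This makes the junk values of [quantile] outside the open unit interval harmless. *)
Lemma uniform_itv_null : Q (~` [set w | 0 < U w < 1]) = 0%E.
Proof.
have -> : ~` [set w | 0 < U w < 1] = [set w | U w <= 0] `|` [set w | 1 <= U w].
  apply/seteqP; split => w /=.
    by move=> /negP; rewrite negb_and -!leNgt => /orP[]; [left|right].
  by move=> [] h; apply/negP; rewrite negb_and -!leNgt h ?orbT.
have Q1 : Q [set w | 1 <= U w] = 0%E by rewrite uniform_ge ?lexx ?ler01// subrr.
rewrite measureU0//.
- by apply: (unifU.2 0); rewrite lexx ler01.
- exact: measurable_le_set.
- rewrite (_ : [set w | 1 <= U w] = ~` [set w | U w < 1]).
    by apply: measurableC; exact: measurable_lt_set.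
  by apply/seteqP; split => w /=; rewrite leNgt => /negP.
Qed.

End uniform.

Section ae_measure.
Context {R : realType} {d : measure_display} {S : measurableType d}.

Lemma measure_eq_mod_null (Q : {measure set S -> \bar R}) (N A B : set S) :
  measurable N -> measurable A -> measurable B -> Q N = 0%E ->
  A `\` N = B `\` N -> Q A = Q B.
Proof.
move=> mN mA mB N0 AB.
rewrite (measureDI Q mA mN) (measureDI Q mB mN) AB.
have I0 C : measurable C -> Q (C `&` N) = 0%E.
  move=> mC; apply: (subset_measure0 _ mN _ N0); first exact: measurableI.
  exact: subIsetr.
by congr adde; rewrite [LHS]I0 1?[RHS]I0.
Qed.

End ae_measure.

Section quantile_transform.
Context {R : realType} {d : measure_display} {T : measurableType d}.
Variables (P : probability T R) (X : T -> R) (mX : measurable_fun setT X).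

(** By the Galois connection, the event that the transformed variable is at most [x] agrees with
    [U <= prob_le P X x] off the null set where [U] leaves the open unit interval. *)
Lemma quantile_uniform_law {d'} {S : measurableType d'} (Q : probability S R)
    (U : S -> R) : is_uniform Q U ->
  forall B : set R, measurable B ->
    Q ((quantile P X \o U) @^-1` B) = P (X @^-1` B).
Proof.
move=> unifU; have mU := unifU.1.
have mqU : measurable_fun setT (quantile P X \o U).
  by apply: measurableT_comp => //; exact: measurable_quantile.
apply: same_cdf_law => // x.
rewrite (prob_leE P mX x) -(unifU.2 (prob_le P X x)); last first.
  by rewrite prob_le_ge0 prob_le_le1.
have mE : measurable [set w | 0 < U w < 1].
  rewrite (_ : mkset _ = U @^-1` `]0, 1[%classic).
    by rewrite -[X in measurable X]setTI; exact: mU.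
  by apply/seteqP; split => w /=; rewrite in_itv.
apply: (@measure_eq_mod_null _ _ _ Q (~` [set w | 0 < U w < 1])).
- exact: measurableC.
- exact: measurable_le_set.
- exact: measurable_le_set.
- exact: uniform_itv_null.
- rewrite !setDE setCK; apply/seteqP; split => w /= [h w01]; split => //.
    by rewrite -quantile_le.
  by rewrite quantile_le.
Qed.

End quantile_transform.

Section same_law_integral.
Context {R : realType} {d d' : measure_display} {T : measurableType d}
  {S : measurableType d'}.
Variables (P : probability T R) (Q : probability S R).
Variables (X : T -> R) (Y : S -> R).
Hypotheses (mX : measurable_fun setT X) (mY : measurable_fun setT Y).
Hypothesis XY : forall B : set R, measurable B -> Q (Y @^-1` B) = P (X @^-1` B).
Local Open Scope ereal_scope.

Lemma ge0_integral_same_law (g : R -> \bar R) :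
  measurable_fun setT g -> (forall x, 0 <= g x) ->
  \int[Q]_w g (Y w) = \int[P]_w g (X w).
Proof.
move=> mg g0.
pose Y' : {mfun S >-> R} := HB.pack Y (isMeasurableFun.Build _ _ _ _ Y mY).
pose X' : {mfun T >-> R} := HB.pack X (isMeasurableFun.Build _ _ _ _ X mX).
rewrite -[LHS](@ge0_integral_distribution _ _ _ _ _ Q Y' g)//.
rewrite -[RHS](@ge0_integral_distribution _ _ _ _ _ P X' g)//.
by apply: eq_measure_integral => A mA _; exact: XY.
Qed.

End same_law_integral.

(** * Expectations as integrals of the quantile function *)

Section quantile_integral.
Context {R : realType} {d : measure_display} {T : measurableType d}.
Variable P : probability T R.
Local Notation mu := (@lebesgue_measure R).

Lemma is_uniform_id : is_uniform (uniform_prob (@ltr01 R)) id.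
Proof.
split => // y y01; rewrite [LHS](integral_uniform_pdf 0 1).
have -> : [set w | w <= y] `&` `[0, 1] = `[0, y]%classic.
  apply/seteqP; split => x /=; rewrite !in_itv/=; lra.
rewrite (eq_integral (cst 1%E)) ?integral_cst//=.
  rewrite lebesgue_measure_itv/= lte_fin mul1e; case: ifPn => [_|].
    by rewrite sube0.
  by rewrite -leNgt => y0; congr EFin; lra.
move=> x; rewrite inE/= in_itv/= /uniform_pdf => xy.
by rewrite ifT ?subr0 ?invr1//; lra.
Qed.

Variables (X : T -> R) (mX : measurable_fun setT X).
Local Open Scope ereal_scope.

(** The quantile transform applied to the identity, which is uniform under [uniform_prob]. *)
Lemma ge0_integral_quantile (g : R -> \bar R) :
  measurable_fun setT g -> (forall x, 0 <= g x) ->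
  \int[mu]_(b in `]0%R, 1%R[) g (quantile P X b) = \int[P]_w g (X w).
Proof.
move=> mg g0.
rewrite -(@ge0_integral_same_law _ _ _ _ _ P (uniform_prob ltr01) X
  (quantile P X) mX)//.
- have mgq : measurable_fun setT (g \o quantile P X).
    by apply: measurableT_comp => //; exact: measurable_quantile.
  rewrite (integral_uniform _ (f := g \o quantile P X))//; last by move=> x /=.
  rewrite subr0 invr1 mul1e -integral_itv_obnd_cbnd ?integral_itv_bndo_bndc//.
  - by apply: measurable_funTS; exact: mgq.
  - by apply: measurable_funTS; exact: mgq.
- exact: measurable_quantile.
- by move=> B mB; have := quantile_uniform_law P mX is_uniform_id mB.
Qed.

Lemma integrable_quantile : P.-integrable setT (EFin \o X) ->
  mu.-integrable setT (EFin \o quantile P X).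
Proof.
move=> /integrableP[_ intX].
have mq := measurable_quantile P mX.
rewrite [X in _.-integrable _ X](_ : _ =
    (EFin \o quantile P X) \_ `]0%R, 1%R[); last first.
  apply/funext => b; rewrite patchE /= /quantile patchE.
  by case: ifP => // ->.
apply/integrable_restrict => //; rewrite setTI.
apply/integrableP; split; first exact/measurable_EFinP/measurable_funTS.
rewrite (ge0_integral_quantile (g := fun x => `|x%:E|))//.
by apply/measurable_EFinP; exact: normr_measurable.
Qed.

End quantile_integral.

(** * Uniform variables on atomless spaces *)

Section atomless_uniform.
Context {R : realType} {d : measure_display} {T : measurableType d}.
Variable P : probability T R.
Hypothesis atomlessP : atomless P.

Let m (A : set T) : R := fine (P A).

Let PE A : measurable A -> P A = (m A)%:E.
Proof. by move=> mA; rewrite fineK// fin_num_measure. Qed.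

Let m_ge0 A : 0 <= m A. Proof. exact: fine_ge0. Qed.

Let m_le A B : measurable A -> measurable B -> A `<=` B -> m A <= m B.
Proof. by move=> mA mB AB; rewrite -lee_fin -!PE// le_measure ?inE. Qed.

Let m_setD A B : measurable A -> measurable B -> B `<=` A ->
  m (A `\` B) = m A - m B.
Proof.
move=> mA mB BA; apply: EFin_inj; rewrite EFinB -!PE//; last exact: measurableD.
rewrite measureD//; first by rewrite setIidr.
by rewrite -ge0_fin_numE// fin_num_measure.
Qed.

Let m_setT : m setT = 1.
Proof. by rewrite /m probability_setT. Qed.

(** Atomlessness splits a set in an unknown ratio; keeping the lighter part at least halves the mass
    each time. *)
Lemma atomless_small (A : set T) (e : R) : measurable A -> 0 < m A -> 0 < e ->
  exists B, [/\ measurable B, B `<=` A, 0 < m B & m B <= e].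
Proof.
move=> mA A0 e0.
have half n : exists B,
    [/\ measurable B, B `<=` A, 0 < m B & m B <= m A / 2 ^+ n].
  elim: n => [|n [B [mB BA B0 Bn]]].
    by exists A; rewrite expr0 divr1; split.
  have [|C [mC CB]] := atomlessP mB; first by rewrite PE// lte_fin.
  rewrite !PE// !lte_fin => C0 CltB.
  have DE := m_setD mB mC CB.
  have [h|h] := leP (m C) (m B / 2).
    exists C; split => //; first exact: subset_trans BA.
    rewrite exprSr invfM mulrA; lra.
  exists (B `\` C); split => //.
  - exact: measurableD.
  - by move=> w [/BA].
  - by rewrite DE subr_gt0.
  - rewrite DE exprSr invfM mulrA; lra.
have [n ne] : exists n : nat, m A / 2 ^+ n <= e.
  exists (Num.truncn (m A / e)).
  rewrite ler_pdivrMr ?exprn_gt0// -ler_pdivrMl// mulrC.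
  rewrite (le_trans (ltW (truncnS_gt _)))// -natrX ler_nat.
  exact: ltn_expl.
have [B [mB BA B0 Bn]] := half n.
by exists B; split => //; exact: le_trans ne.
Qed.

(* Sierpinski's theorem, by exhaustion: each step adds at least half of what
   can still be added without exceeding [t]. *)
Lemma atomless_intermediate (A : set T) (t : R) : measurable A -> 0 <= t <= m A ->
  exists B, [/\ measurable B, B `<=` A & m B = t].
Proof.
move=> mA /andP[t0 tA].
pose K := [set B : set T | [/\ measurable B, B `<=` A & m B <= t]].
(* The inequality says that [C] gains at least half of what any competitor [C'] gains over [B]. The
   premise [K B] stands under the existential so that [choice] returns a total function. *)
have stepE B : exists C, K B -> [/\ K C, B `<=` C &
    forall C', K C' -> B `<=` C' -> m C' <= 2 * m C - m B].
  have [KB|nKB] := pselect (K B); last by exists B => /nKB.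
  pose E := [set m C | C in [set C | K C /\ B `<=` C]].
  have Esup : has_sup E.
    split; first by exists (m B); exists B => /=; first split.
    by exists t => _ [C [[_ _ Ct] _] <-].
  have Eub C : K C -> B `<=` C -> m C <= sup E.
    by move=> KC BC; apply: ub_le_sup; [exact: Esup.2 | exists C].
  have [BE|BE] := leP (sup E) (m B).
    exists B => _; split => // C KC BC.
    by have := Eub _ KC BC; lra.
  have e0 : 0 < (sup E - m B) / 2 by lra.
  have [_ [C [KC BC] <-] CE] := sup_adherent e0 Esup.
  exists C => _; split => // C' KC' BC'.
  by have := Eub _ KC' BC'; lra.
have [step stepP] := choice stepE.
pose B := fix B n := if n is n'.+1 then step (B n') else set0.
have KB n : K (B n).
  elim: n => [|n /stepP[]//].
  by split => //=; rewrite /m measure0.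
have Bsub n : B n `<=` B n.+1 by have [] := stepP _ (KB n).
have Bmax n C : K C -> B n.+1 `<=` C -> m C <= 2 * m (B n.+1) - m (B n).
  move=> KC BC; have [_ _] := stepP _ (KB n); apply => //.
  exact: subset_trans BC.
have mB n : measurable (B n) by have [] := KB n.
pose U := \bigcup_n B n.
have mU : measurable U by exact: bigcup_measurable.
have BU n : B n `<=` U by exact: bigcup_sup.
have Bcvg : m (B n) @[n --> \oo] --> m U.
  apply: fine_cvg; rewrite -PE//; apply: nondecreasing_cvg_mu => //.
  apply/nondecreasing_seqP => n; exact/subsetPset.
have UA : U `<=` A by apply: bigcup_sub => n _; have [] := KB n.
have Ut : m U <= t.
  apply: (closed_cvg _ (@closed_le _ t) _ _ Bcvg) => //.
  by apply: nearW => n; have [] := KB n.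
exists U; split => //; apply/eqP; rewrite eq_le Ut /= leNgt; apply/negP => Ult.
have DE := m_setD mA mU UA.
have [|||D [mD DAU D0 Dt]] := @atomless_small (A `\` U) (t - m U).
- exact: measurableD.
- by rewrite DE; lra.
- by rewrite subr_gt0.
have UDE : m (U `|` D) = m U + m D.
  apply: EFin_inj; rewrite EFinD -!PE//; last exact: measurableU.
  rewrite measureU//; apply/seteqP; split => // w [Uw /DAU[]//].
have KUD : K (U `|` D).
  split; first exact: measurableU.
  - by move=> w [/UA|/DAU[]].
  - by rewrite UDE; lra.
(* The enlarged set competes at every step; in the limit its mass is at most that of [U], which
   contradicts [0 < m D]. *)
have : m (U `|` D) <= 2 * m U - m U.
  have : (2 * m U - m (B n)) @[n --> \oo] --> 2 * m U - m U.
    by apply: cvgB => //; exact: cvg_cst.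
  move=> h; apply: (closed_cvg _ (@closed_ge _ (m (U `|` D))) _ _ h) => //.
  apply: nearW => n /=.
  apply: le_trans (Bmax n _ KUD _) _.
    by apply: subset_trans (BU _) _; exact: subsetUl.
  by rewrite lerD2r ler_wpM2l// m_le.
by rewrite UDE; lra.
Qed.

Lemma atomless_between (A B : set T) : measurable A -> measurable B -> A `<=` B ->
  exists C, [/\ measurable C, A `<=` C, C `<=` B & m C = (m A + m B) / 2].
Proof.
move=> mA mB AB; have DE := m_setD mB mA AB.
have [||D [mD DBA Dm]] := @atomless_intermediate (B `\` A) ((m B - m A) / 2).
- exact: measurableD.
- by have := m_le mA mB AB; rewrite DE; lra.
exists (A `|` D); split.
- exact: measurableU.
- exact: subsetUl.
- by move=> w [/AB|/DBA[]].
- have -> : m (A `|` D) = m A + m D.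
    apply: EFin_inj; rewrite EFinD -!PE//; last exact: measurableU.
    rewrite measureU//; apply/seteqP; split => // w [Aw /DBA[]//].
  by lra.
Qed.

(** [c n k] stands for the event that the future uniform variable is at most k / 2^n. The third
    clause makes the levels compatible: refining only inserts sets halfway between neighbours. *)
Lemma atomless_dyadic_chain : exists c : nat -> nat -> set T,
  [/\ forall n k, measurable (c n k),
      forall n k, c n k `<=` c n k.+1,
      forall n k, c n.+1 k.*2 = c n k,
      c 0%N 1%N = setT &
      forall n k, (k <= 2 ^ n)%N -> m (c n k) = k%:R / 2 ^+ n].
Proof.
have midE (AB : set T * set T) : exists C,
    measurable AB.1 -> measurable AB.2 -> AB.1 `<=` AB.2 ->
    [/\ measurable C, AB.1 `<=` C, C `<=` AB.2 & m C = (m AB.1 + m AB.2) / 2].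
  case: AB => A B /=.
  have [[[mA mB] AB]|h] := pselect ((measurable A /\ measurable B) /\ A `<=` B).
    by have [C CP] := atomless_between mA mB AB; exists C.
  by exists set0 => mA mB AB; exfalso; apply: h.
have [mid midP] := choice midE.
pose c := fix c n : nat -> set T := if n is n'.+1
  then fun k => if odd k then mid (c n' k./2, c n' k./2.+1) else c n' k./2
  else fun k => if k is 0%N then set0 else setT.
have cP n : (forall k, measurable (c n k)) /\ (forall k, c n k `<=` c n k.+1).
  elim: n => [|n [mc sc]].
    by split => -[|k] //=.
  have midc k := midP (c n k, c n k.+1) (mc _) (mc _) (sc _).
  split => k /=; first by case: ifP => _ //; have [] := midc k./2.
  case: (boolP (odd k)) => ok /=.
    have -> : uphalf k = k./2.+1 by rewrite uphalf_half ok.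
    by have [] := midc k./2.
  have -> : uphalf k = k./2 by rewrite uphalf_half (negbTE ok).
  by have [] := midc k./2.
exists c; split.
- by move=> n; have [] := cP n.
- by move=> n; have [] := cP n.
- by move=> n k /=; rewrite odd_double doubleK.
- by [].
elim => [|n IH] k.
  case: k => [|[|]]//= _; first by rewrite /m measure0 mul0r.
  by rewrite m_setT expr0 divr1.
move=> kn /=; have [mc sc] := cP n.
have kE := odd_double_half k; case: (boolP (odd k)) kE => /= ok kE.
  have k2 : (k./2.+1 <= 2 ^ n)%N.
    by move: kn kE; rewrite expnS; move: (2 ^ n)%N => N; lia.
  have [_ _ _ ->] := midP (c n k./2, c n k./2.+1) (mc _) (mc _) (sc _).
  rewrite !IH//=; last exact: ltnW.
  rewrite -[in RHS]kE natrD -muln2 natrM -natr1 exprSr invfM; field.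
  by rewrite expf_neq0.
rewrite IH; last by move: kn kE; rewrite expnS; move: (2 ^ n)%N => N; lia.
rewrite -[in RHS]kE add0n -muln2 natrM exprSr invfM; field.
by rewrite expf_neq0.
Qed.

(** The variable is the infimum of the dyadic labels whose set contains the point. Its strict
    sublevel sets are countable unions from the chain, with masses squeezed between neighbouring
    dyadics. *)
Theorem atomless_uniform : exists U : T -> R,
  is_uniform P U /\ forall w, 0 <= U w < 1.
Proof.
have [c [mc sc c2 c1 mcE]] := atomless_dyadic_chain.
have cmon n j k : (j <= k)%N -> c n j `<=` c n k.
  by move=> /subnKC <-; elim: (k - j)%N => [|i IH]; rewrite ?addn0// addnS;
    exact: subset_trans (sc _ _).
have cshift p n k : c (p + n)%N (k * 2 ^ p)%N = c n k.
  elim: p => [|p IH]; first by rewrite add0n expn0 muln1.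
  by rewrite addSn expnS mulnCA mul2n c2.
(* Both sets are moved to the common level [n + n'], where the chain is monotone in its index. *)
have ccomp n j n' k : j%:R / 2 ^+ n <= k%:R / 2 ^+ n' :> R -> c n j `<=` c n' k.
  rewrite ler_pdivrMr ?exprn_gt0// mulrAC ler_pdivlMr ?exprn_gt0//.
  rewrite -!natrX -!natrM ler_nat => jk.
  rewrite -(cshift n' n j) -(cshift n n' k) [(n + n')%N]addnC; exact: cmon.
pose E w := [set x : R | exists n k, x = k%:R / 2 ^+ n /\ c n k w].
have E1 w : E w 1 by exists 0%N, 1%N; rewrite expr0 divr1 c1.
have Elb w : lbound (E w) 0.
  by move=> _ [n [k [-> _]]]; rewrite divr_ge0// exprn_ge0.
have Einf w : has_inf (E w) by split; [exists 1 | exists 0].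
pose U0 w := inf (E w).
have U0_ge0 w : 0 <= U0 w by apply: lb_le_inf => //; exists 1.
have U0_lt y : [set w | U0 w < y] =
    \bigcup_n \bigcup_(k in [set k : nat | k%:R / 2 ^+ n < y]) c n k.
  apply/seteqP; split => w /=.
    move=> /(inf_lt (ex_intro _ 1 (E1 w)))[_ [n [k [-> ck]]] ky].
    by exists n => //; exists k.
  move=> [n _ [k /= ky ck]]; apply: le_lt_trans ky.
  by apply: ge_inf; [exists 0 | exists n, k].
have mU0lt y : measurable [set w | U0 w < y].
  rewrite U0_lt; apply: bigcup_measurable => n _.
  by apply: bigcup_measurable => k _.
have mU0 : measurable_fun setT U0.
  apply: (measurability (@RGenInftyO.G R)) => [|/= _ [_] [r] -> <-].
    exact: RGenInftyO.measurableE.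
  rewrite setTI; have -> : U0 @^-1` `]-oo, r[ = [set w | U0 w < r] by
    apply/seteqP; split => w /=; rewrite in_itv.
  exact: mU0lt.
have grid (y e : R) : 0 < e -> 0 < y -> exists n t,
    [/\ 2 / 2 ^+ n <= e, t%:R / 2 ^+ n <= y & y < t.+1%:R / 2 ^+ n].
  move=> e0 y0; pose n := Num.truncn (2 / e).
  have n0 : 0 < (2 : R) ^+ n by rewrite exprn_gt0.
  exists n, (Num.truncn (y * 2 ^+ n)); split.
  - rewrite ler_pdivrMr// -ler_pdivrMl// mulrC (le_trans (ltW (truncnS_gt _)))//.
    by rewrite -natrX ler_nat; exact: ltn_expl.
  - by rewrite ler_pdivrMr// truncn_le// mulr_ge0// ltW.
  - by rewrite ltr_pdivlMr// truncnS_gt.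
have PU0 y : 0 < y <= 1 -> m [set w | U0 w < y] = y.
  move=> /andP[y0 y1]; apply/eqP; rewrite eq_le; apply/andP; split;
    apply/ler_addgt0Pr => e e0; have [n [t [ne tl tu]]] := grid y e e0 y0;
    have n0 : 0 < (2 : R) ^+ n by rewrite exprn_gt0.
    move: y1; rewrite le_eqVlt => /predU1P[->|y1].
      apply: (@le_trans _ _ 1); last by rewrite lerDl ltW.
      by rewrite -[leRHS]m_setT m_le.
    have tn : (t.+1 <= 2 ^ n)%N.
      rewrite -(ltr_nat R) natrX.
      move: tl; rewrite ler_pdivrMr// => /le_lt_trans; apply.
      by rewrite gtr_pMl.
    apply: (@le_trans _ _ (m (c n t.+1))).
      apply: m_le => //; rewrite U0_lt; apply: bigcup_sub => n' _.
      apply: bigcup_sub => k /= ky; apply: ccomp; apply: ltW.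
      exact: lt_trans tu.
    rewrite mcE// -natr1 mulrDl mul1r.
    have : 0 < (2 ^+ n)^-1 :> R by rewrite invr_gt0.
    by lra.
  (* [t.-1] and not [t]: the union describing [U0 w < y] takes labels strictly below [y], and the
     label of [t] may equal [y]. The two cells between [t.-1] and [t.+1] explain the factor 2 in
     [grid]. *)
  have ty : t.-1%:R / 2 ^+ n < y.
    case: {tu} t tl => [|k] /= tl; first by rewrite mul0r.
    apply: lt_le_trans tl; rewrite ltr_pM2r ?invr_gt0// ltr_nat//.
  apply: (@le_trans _ _ (m (c n t.-1) + e)).
    rewrite mcE; last first.
      rewrite -(ler_nat R) natrX -[leRHS]mul1r -ler_pdivrMr//.
      by rewrite (le_trans (ltW ty)).
    have : t.+1%:R / 2 ^+ n <= t.-1%:R / 2 ^+ n + 2 / 2 ^+ n :> R.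
      rewrite -mulrDl ler_wpM2r ?invr_ge0 ?(ltW n0)// -natrD ler_nat; lia.
    by lra.
  rewrite lerD2r m_le// U0_lt => w cw; exists n => //; exists t.-1 => //.
have U0_null : m [set w | 1 <= U0 w] = 0.
  have -> : [set w | 1 <= U0 w] = setT `\` [set w | U0 w < 1].
    apply/seteqP; split => w /=; first by rewrite leNgt => /negP.
    by move=> [_ /negP]; rewrite -leNgt.
  by rewrite m_setD// m_setT PU0 ?subrr// ltr01 lexx.
(* Resetting the value 1 on a null set places [U] in [[0, 1[] at every point, as [uniform_rotation]
   requires. *)
pose U w := if U0 w < 1 then U0 w else 0.
have U01 w : 0 <= U w < 1.
  by rewrite /U; case: ifPn => [->|_]; rewrite ?U0_ge0 ?lexx ?ltr01.
have mU : measurable_fun setT U.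
  apply: measurable_fun_ifT => //; exact: measurable_fun_ltr.
exists U; split => //; split => // y /andP[y0 y1].
rewrite PE; last exact: measurable_le_set.
congr EFin; apply/eqP; rewrite eq_le; apply/andP; split; last first.
  have [->|yn0] := eqVneq y 0; first exact: m_ge0.
  apply: (@le_trans _ _ (m [set w | U0 w < y])).
    by rewrite PU0// y1 lt_neqAle eq_sym yn0 y0.
  apply: m_le => //; first exact: measurable_le_set.
  move=> w /= Uy; rewrite /U; case: ifP => _; [exact: ltW | exact: y0].
have [->|yn1] := eqVneq y 1.
  by rewrite -[leRHS]m_setT m_le//; exact: measurable_le_set.
apply/ler_addgt0Pr => e e0; pose z := Num.min (y + e) 1.
have z01 : 0 < z <= 1 by rewrite /z; case: (leP (y + e) 1); lra.
have mge : measurable [set w | 1 <= U0 w].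
  have -> : [set w | 1 <= U0 w] = ~` [set w | U0 w < 1].
    by apply/seteqP; split => w /=; rewrite leNgt => /negP.
  exact: measurableC.
apply: (@le_trans _ _ (m ([set w | U0 w < z] `|` [set w | 1 <= U0 w]))).
  apply: m_le; [exact: measurable_le_set | exact: measurableU |].
  move=> w /=; rewrite /U; case: (ltP (U0 w) 1) => h Uy; last by right.
  by left; rewrite /z; case: (leP (y + e) 1); lra.
have -> : m ([set w | U0 w < z] `|` [set w | 1 <= U0 w]) = m [set w | U0 w < z].
  by congr fine; apply: measureU0 => //; rewrite [LHS](PE mge) U0_null.
by rewrite PU0// /z; case: (leP (y + e) 1); lra.
Qed.

End atomless_uniform.

(** * Convexity of the expected shortfall *)

Section tail_integral.
Context {R : realType} {d : measure_display} {T : measurableType d}.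
Variable P : probability T R.
Local Notation mu := (@lebesgue_measure R).

Definition tail_integral (a : R) (X : T -> R) : R :=
  \int[mu]_(b in `]a, 1[) quantile P X b.

Definition mean_excess (k : R) (X : T -> R) : R :=
  \int[P]_w Num.max (X w - k) 0.

(** For [a = 0] the second clause is vacuous, and the first asks for a lower bound of all quantiles,
    including the junk value 0 at level 0. *)
Definition threshold (a : R) (X : T -> R) (c : R) :=
  (forall b, a <= b < 1 -> c <= quantile P X b) /\
  (forall b, 0 < b <= a -> quantile P X b <= c).

Lemma integrable_quantile_sub (D : set R) (X : T -> R) :
  measurable D -> L1 P X -> mu.-integrable D (EFin \o quantile P X).
Proof.
move=> mD [mX iX]; apply: (@integrableS _ _ _ mu setT) => //.
exact: integrable_quantile.
Qed.

Lemma integrable_cst_lty d' (S : measurableType d')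
    (nu : {measure set S -> \bar R}) (D : set S) (k : R) :
  measurable D -> (nu D < +oo)%E -> nu.-integrable D (EFin \o (fun=> k)).
Proof.
move=> mD Doo; apply/integrableP; split; first exact/measurable_EFinP.
by rewrite (eq_integral (cst `|k|%:E))// integral_cst// lte_mul_pinfty//.
Qed.

Lemma integrable_excess d' (S : measurableType d')
    (nu : {measure set S -> \bar R}) (D : set S) (f : S -> R) (k : R) : measurable D -> (nu D < +oo)%E ->
  nu.-integrable D (EFin \o f) ->
  nu.-integrable D (EFin \o (fun x => Num.max (f x - k) 0)).
Proof.
move=> mD Doo intf.
have ifk : nu.-integrable D (EFin \o (fun x => f x - k)).
  rewrite (_ : EFin \o _ = (EFin \o f) \- (EFin \o cst k))%E; last first.
    by apply/funext => x /=; rewrite EFinB.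
  apply: integrableB => //.
  exact: integrable_cst_lty.
apply: (le_integrable mD _ _ ifk) => [|x Dx].
  apply/measurable_EFinP; apply: measurable_maxr => //.
  by have /measurable_EFinP := measurable_int _ ifk.
by rewrite lee_fin; case: (leP (f x - k) 0) => h; rewrite ?normr0.
Qed.

Lemma lebesgue_itv_lty (b b' : bool) (x y : R) :
  (mu [set` Interval (BSide b x) (BSide b' y)] < +oo)%E.
Proof.
by rewrite lebesgue_measure_itv/=; case: ifP => _; rewrite -?EFinB ltry.
Qed.

Lemma ES_tail_integral (a : R) (X : T -> R) : 0 <= a < 1 -> L1 P X ->
  ES P a X = ((1 - a)^-1 * tail_integral a X)%:E.
Proof.
move=> /andP[a0 a1] LX; rewrite /ES a1 EFinM; congr (_ * _)%E.
rewrite /tail_integral /Rintegral fineK; last first.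
  by apply: integrable_fin_num => //; exact: integrable_quantile_sub.
apply: eq_integral => b; rewrite inE/= in_itv/= => /andP[ab b1].
by rewrite VaR_quantile//; [exact: LX.1 | rewrite b1 (le_lt_trans a0)].
Qed.

Lemma mean_excess_quantile (k : R) (X : T -> R) : measurable_fun setT X ->
  mean_excess k X = \int[mu]_(b in `]0, 1[) Num.max (quantile P X b - k) 0.
Proof.
move=> mX; rewrite /mean_excess /Rintegral; congr fine.
have mg : measurable_fun setT (fun x : R => (Num.max (x - k) 0)%:E).
  by apply/measurable_EFinP; apply: measurable_maxr => //; exact: measurable_funB.
rewrite (ge0_integral_quantile P mX mg)//.
by move=> x; rewrite lee_fin le_max lexx orbT.
Qed.

(** Integrate q <= k + (q - k)^+ over []a, 1[], then enlarge the domain of the nonnegative term to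
    []0, 1[]. *)
Lemma tail_integral_le (a k : R) (X : T -> R) : 0 <= a < 1 -> L1 P X ->
  tail_integral a X <= (1 - a) * k + mean_excess k X.
Proof.
move=> /andP[a0 a1] LX; rewrite mean_excess_quantile//; last exact: LX.1.
have iq D : measurable D -> (mu D < +oo)%E ->
    mu.-integrable D (EFin \o (fun b => Num.max (quantile P X b - k) 0)).
  move=> mD Doo; apply: integrable_excess => //; exact: integrable_quantile_sub.
have -> : (1 - a) * k = \int[mu]_(b in `]a, 1[) k.
  rewrite Rintegral_cst//= lebesgue_measure_itv/= lte_fin a1 -EFinB/=.
  by rewrite mulrC.
apply: (@le_trans _ _ (\int[mu]_(b in `]a, 1[) k +
   \int[mu]_(b in `]a, 1[) Num.max (quantile P X b - k) 0)).
  rewrite -RintegralD//; last 2 first.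
  - by apply: integrable_cst_lty => //; exact: lebesgue_itv_lty.
  - by apply: iq => //; exact: lebesgue_itv_lty.
  apply: le_Rintegral => //.
  - exact: integrable_quantile_sub.
  - rewrite (_ : EFin \o _ = (EFin \o cst k) \+
      (EFin \o (fun b => Num.max (quantile P X b - k) 0)%R))%E; last first.
      by apply/funext => x /=; rewrite EFinD.
    apply: integrableD => //.
    + by apply: integrable_cst_lty => //; exact: lebesgue_itv_lty.
    + by apply: iq => //; exact: lebesgue_itv_lty.
  - by move=> b _; rewrite -lerBlDl le_max lexx.
rewrite lerD2l /Rintegral fine_le//.
- by apply: integrable_fin_num => //; apply: iq => //; exact: lebesgue_itv_lty.
- by apply: integrable_fin_num => //; apply: iq => //; exact: lebesgue_itv_lty.
- apply: ge0_subset_integral => //.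
  + by apply: (measurable_int mu); apply: iq => //; exact: lebesgue_itv_lty.
  + by move=> b _; rewrite lee_fin le_max lexx orbT.
  + by apply: subset_itvr; rewrite bnd_simp.
Qed.

(** At a threshold nothing is lost in [tail_integral_le]: the positive part vanishes on []0, a]] and
    equals q - c on []a, 1[]. *)
Lemma tail_integral_threshold (a c : R) (X : T -> R) : 0 <= a < 1 -> L1 P X ->
  threshold a X c -> (1 - a) * c + mean_excess c X = tail_integral a X.
Proof.
move=> /andP[a0 a1] LX [cq qc]; rewrite mean_excess_quantile//; last exact: LX.1.
have iq D : measurable D -> (mu D < +oo)%E ->
    mu.-integrable D (EFin \o (fun b => Num.max (quantile P X b - c) 0)).
  move=> mD Doo; apply: integrable_excess => //; exact: integrable_quantile_sub.
have -> : (1 - a) * c = \int[mu]_(b in `]a, 1[) c.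
  rewrite Rintegral_cst//= lebesgue_measure_itv/= lte_fin a1 -EFinB/=.
  by rewrite mulrC.
have E01 : `]0, 1[%classic = `]0, a] `|` `]a, 1[%classic.
  apply/seteqP; split => x /=; rewrite !in_itv/=.
    by move=> /andP[-> ->]; case: (leP x a) => _; [left|right].
  move=> [|] /andP[x1 x2]; apply/andP; split => //.
    exact: le_lt_trans a1.
  exact: le_lt_trans x1.
rewrite E01 Rintegral_setU//; last 2 first.
- by rewrite -E01; apply: iq => //; exact: lebesgue_itv_lty.
- apply/disj_set2P; rewrite -subset0 => x /= []; rewrite !in_itv/=.
  by move=> /andP[_ xa] /andP[ax _]; move: ax; rewrite ltNge xa.
rewrite [X in _ + (X + _)](_ : _ = 0) ?add0r; last first.
  rewrite (@eq_Rintegral _ _ _ _ _ (fun=> 0)).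
    by rewrite Rintegral_cst ?mul0r.
  move=> b; rewrite inE/= in_itv/= => /qc qbc.
  by apply/max_idPr; rewrite subr_le0.
rewrite -RintegralD//; last 2 first.
- by apply: integrable_cst_lty => //; exact: lebesgue_itv_lty.
- by apply: iq => //; exact: lebesgue_itv_lty.
apply: eq_Rintegral => b; rewrite inE/= in_itv/= => /andP[ab b1].
have /max_idPl -> : 0 <= quantile P X b - c by rewrite subr_ge0 cq// ltW.
by rewrite addrC subrK.
Qed.

Lemma L1_convex (X Y : T -> R) (g : R) : L1 P X -> L1 P Y ->
  L1 P (fun w => g * X w + (1 - g) * Y w).
Proof.
move=> [mX iX] [mY iY]; split.
  by apply: measurable_funD; exact: measurable_funM.
rewrite (_ : EFin \o _ =
    ((fun w => g%:E * (EFin \o X) w) \+ (fun w => (1 - g)%:E * (EFin \o Y) w)))%E.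
  by apply: integrableD => //; exact: integrableZl.
by apply/funext => w /=; rewrite EFinD !EFinM.
Qed.

(** Joint convexity in level and variable: X - k is linear in the pair, and the positive part is
    sublinear. *)
Lemma mean_excess_convex (X Y : T -> R) (g k l : R) : 0 <= g <= 1 ->
  L1 P X -> L1 P Y ->
  mean_excess (g * k + (1 - g) * l) (fun w => g * X w + (1 - g) * Y w) <=
  g * mean_excess k X + (1 - g) * mean_excess l Y.
Proof.
move=> /andP[g0 g1] LX LY.
have Poo : (P setT < +oo)%E by rewrite probability_setT ltry.
have iX := integrable_excess k measurableT Poo LX.2.
have iY := integrable_excess l measurableT Poo LY.2.
have iZ := integrable_excess (g * k + (1 - g) * l) measurableT Poo
  (L1_convex g LX LY).2.
rewrite /mean_excess -(RintegralZl _ _ iX)// -(RintegralZl _ _ iY)//.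
have igX : P.-integrable setT (EFin \o (fun w => g * Num.max (X w - k) 0)).
  by rewrite (_ : EFin \o _ = fun w => g%:E *
    (EFin \o (fun w => Num.max (X w - k) 0)%R) w)%E//; exact: integrableZl.
have igY : P.-integrable setT (EFin \o (fun w => (1 - g) * Num.max (Y w - l) 0)).
  by rewrite (_ : EFin \o _ = fun w => (1 - g)%:E *
    (EFin \o (fun w => Num.max (Y w - l) 0)%R) w)%E//; exact: integrableZl.
rewrite -RintegralD//; apply: le_Rintegral => //.
  rewrite (_ : EFin \o _ =
    ((EFin \o (fun w => g * Num.max (X w - k) 0)%R) \+
     (EFin \o (fun w => (1 - g) * Num.max (Y w - l) 0)%R)))%E.
    exact: integrableD.
  by apply/funext => w /=; rewrite EFinD.
move=> w _; rewrite ge_max; apply/andP; split.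
  rewrite (_ : _ - _ = g * (X w - k) + (1 - g) * (Y w - l)); last by lra.
  by rewrite lerD// ler_wpM2l ?subr_ge0// le_max lexx.
by rewrite addr_ge0// mulr_ge0 ?subr_ge0// le_max lexx orbT.
Qed.

Lemma ES_convex (a g c1 c2 : R) (X Y : T -> R) : 0 <= a < 1 -> 0 <= g <= 1 ->
  L1 P X -> L1 P Y -> threshold a X c1 -> threshold a Y c2 ->
  (ES P a (fun w => g * X w + (1 - g) * Y w)%R <=
   g%:E * ES P a X + (1 - g)%:E * ES P a Y)%E.
Proof.
move=> a01 g01 LX LY tX tY; have LZ := L1_convex g LX LY.
rewrite !ES_tail_integral// -!EFinM -EFinD lee_fin.
have -> (u v : R) : g * ((1 - a)^-1 * u) + (1 - g) * ((1 - a)^-1 * v) =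
    (1 - a)^-1 * (g * u + (1 - g) * v) by ring.
apply: ler_wpM2l; first by rewrite invr_ge0; lra.
(* Every level bounds the tail integral of the mixture; the mixture of the two thresholds is the one
   that joint convexity splits. *)
apply: le_trans (tail_integral_le (g * c1 + (1 - g) * c2) a01 LZ) _.
rewrite -(tail_integral_threshold a01 LX tX) -(tail_integral_threshold a01 LY tY).
have := mean_excess_convex c1 c2 g01 LX LY.
lra.
Qed.

End tail_integral.

(** * Rotated copies and Riemann sums *)

Section rotation.
Context {R : realType}.

(** Cyclic shift by [s] of the arc [[a, 1[], of length 1 - a, and the identity below [a]. *)
Definition rotation (a s u : R) : R :=
  if u < a then u else if u < 1 - s then u + s else u + s - (1 - a).

Lemma measurable_rotation (a s : R) : measurable_fun setT (rotation a s).
Proof.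
apply: measurable_fun_ifT => //; first exact: measurable_fun_ltr.
apply: measurable_fun_ifT; first exact: measurable_fun_ltr.
- exact: measurable_funD.
- by apply: measurable_funB => //; exact: measurable_funD.
Qed.

Context {d : measure_display} {T : measurableType d} (P : probability T R).

Lemma uniform_itvcc (U : T -> R) (l h : R) : is_uniform P U ->
  0 <= l -> l <= h -> h <= 1 -> P [set w | l <= U w <= h] = (h - l)%:E.
Proof.
move=> unifU l0 lh h1; have mU := unifU.1.
have -> : [set w | l <= U w <= h] = [set w | U w <= h] `\` [set w | U w < l].
  apply/seteqP; split => w /=; first by move=> /andP[lU ->]; rewrite ltNge lU.
  by move=> [-> /negP]; rewrite -leNgt => ->.
have mh := measurable_le_set mU h; have ml := measurable_lt_set mU l.
rewrite measureD//; last by rewrite -ge0_fin_numE// fin_num_measure.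
rewrite setIidr; last by move=> w /= /ltW /le_trans; apply.
rewrite EFinB; congr (_ - _)%E; first by apply: unifU.2; rewrite h1 (le_trans l0).
by apply: uniform_lt => //; rewrite l0 (le_trans lh).
Qed.

Lemma uniform_rotation (U : T -> R) (a s : R) : is_uniform P U ->
  (forall w, 0 <= U w < 1) -> 0 <= a -> 0 <= s < 1 - a ->
  is_uniform P (rotation a s \o U).
Proof.
move=> unifU U01 a0 /andP[s0 sa]; have mU := unifU.1.
split; first by apply: measurableT_comp => //; exact: measurable_rotation.
move=> y /andP[y0 y1]; rewrite /rotation/=.
have mcc l h : measurable [set w | l <= U w <= h].
  have -> : [set w | l <= U w <= h] = [set w | U w <= h] `\` [set w | U w < l].
    apply/seteqP; split => w /=; first by move=> /andP[lU ->]; rewrite ltNge lU.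
    by move=> [-> /negP]; rewrite -leNgt => ->.
  by apply: measurableD; [exact: measurable_le_set | exact: measurable_lt_set].
have [ya|ay] := ltP y a.
  rewrite -(unifU.2 y) ?y0//; congr (P _); apply/seteqP; split => w /=;
    have /andP[Uw0 Uw1] := U01 w; case: ltP => ? //; case: ltP => *; lra.
(* For such [y], the only points of the arc sent below [y] are wrapped ones, from 1 - s onwards. *)
have [yas|asy] := ltP y (a + s).
  have -> : [set w | (if U w < a then U w else
      if U w < 1 - s then U w + s else U w + s - (1 - a)) <= y] =
      [set w | U w < a] `|` [set w | 1 - s <= U w <= y - s + (1 - a)].
    apply/seteqP; split => w /=; have /andP[Uw0 Uw1] := U01 w.
      case: ltP => ?; first by left.
      by case: ltP => *; right; lra.
    by move=> [|] Uw; case: ltP => *; try lra; case: ltP => *; lra.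
  rewrite measureU//; last 2 first.
  - exact: measurable_lt_set.
  - by apply/seteqP; split => w //= [? ?]; lra.
  transitivity (a%:E + (y - s + (1 - a) - (1 - s))%:E)%E.
    congr (_ + _)%E; first by apply: uniform_lt => //; lra.
    by apply: uniform_itvcc => //; lra.
  by rewrite -EFinD; congr EFin; lra.
(* The value 1 is set apart because the two pieces used for [y < 1] would share the point 1 - s. *)
have [->|yn1] := eqVneq y 1.
  rewrite [X in P X](_ : _ = setT) ?probability_setT//.
  apply/seteqP; split => w //= _; have /andP[Uw0 Uw1] := U01 w.
  by case: ltP => ?; [|case: ltP => ?]; lra.
have {yn1} y1' : y < 1 by rewrite lt_neqAle yn1.
have -> : [set w | (if U w < a then U w else
    if U w < 1 - s then U w + s else U w + s - (1 - a)) <= y] =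
    [set w | U w <= y - s] `|` [set w | 1 - s <= U w <= 1].
  apply/seteqP; split => w /=; have /andP[Uw0 Uw1] := U01 w.
    by case: ltP => ?; [left; lra|case: ltP => *; [left|right]; lra].
  by move=> [|] Uw; case: ltP => *; try lra; case: ltP => *; lra.
rewrite measureU//; last 2 first.
- exact: measurable_le_set.
- by apply/seteqP; split => w //= [? ?]; lra.
transitivity ((y - s)%:E + (1 - (1 - s))%:E)%E.
  congr (_ + _)%E; first by apply: unifU.2; lra.
  by apply: uniform_itvcc => //; lra.
by rewrite -EFinD; congr EFin; lra.
Qed.

Definition grid (a : R) (n j : nat) : R := a + (1 - a) * (j%:R / n%:R).

(** With [k] the cell containing [u], a shift by [i] cells leads to cell [k + i]; the modular
    addition of ['I_N.+1] encodes the wrap-around. *)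
Lemma rotation_grid (a u : R) (N : nat) : 0 <= a -> a <= u < 1 ->
  exists k : 'I_N.+1, forall i : 'I_N.+1,
    grid a N.+1 (k + i)%R <= rotation a ((1 - a) * (i%:R / N.+1%:R)) u < 1.
Proof.
move=> a0 /andP[au u1]; pose n : R := N.+1%:R.
have n0 : 0 < n by rewrite ltr0n.
have a1 : 0 < 1 - a by lra.
pose z := (u - a) / (1 - a) * n.
have z0 : 0 <= z by rewrite mulr_ge0 ?divr_ge0 ?(ltW n0)//; lra.
have uz : u = a + (1 - a) * (z / n) by rewrite /z; field; rewrite !gt_eqF.
have zn : z < n by rewrite /z gtr_pMl// ltr_pdivrMr//; lra.
have kz : (Num.truncn z)%:R <= z by rewrite truncn_le.
have zk : z < (Num.truncn z).+1%:R by rewrite truncnS_gt.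
have kn : (Num.truncn z < N.+1)%N by rewrite -(ltr_nat R) (le_lt_trans kz).
exists (Ordinal kn) => i; move: (Num.truncn z) kz zk kn => k kz zk kn.
clearbody z.
have ilt : (i%:R : R) < n by rewrite ltr_nat.
have iz : (i%:R : R) >= 0 by [].
have step (x y : R) : (x <= y) -> (1 - a) * (x / n) <= (1 - a) * (y / n).
  by move=> xy; rewrite ler_pM2l// ler_pM2r ?invr_gt0.
have steplt (x y : R) : (x < y) -> (1 - a) * (x / n) < (1 - a) * (y / n).
  by move=> xy; rewrite ltr_pM2l// ltr_pM2r ?invr_gt0.
have mulnn : (1 - a) * (n / n) = 1 - a by rewrite divff ?mulr1// gt_eqF.
have mulD (x y : R) :
    (1 - a) * ((x + y) / n) = (1 - a) * (x / n) + (1 - a) * (y / n).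
  by ring.
rewrite /grid /rotation ltNge au/= -/n.
have [kin|nki] := ltnP (k + i) N.+1.
  rewrite modn_small// natrD.
  have : z + i%:R < n.
    apply: lt_le_trans (_ : k.+1%:R + i%:R <= n); first by rewrite ltrD2r.
    by rewrite -natrD ler_nat addSn.
  move=> /steplt; rewrite mulD mulnn => h.
  have := step _ _ kz; rewrite mulD uz.
  move: h; move: (_ * (z / n)) (_ * (i%:R / n)) (_ * (k%:R / n)) => A B C h h'.
  by case: ltP => *; apply/andP; split; lra.
have -> : ((k + i) %% N.+1)%N = (k + i - N.+1)%N.
  by rewrite -[in LHS](subnK nki) modnDr modn_small//; have := ltn_ord i; lia.
rewrite natrB// natrD -/n.
have : n <= z + i%:R.
  apply: (@le_trans _ _ (k%:R + i%:R)); last by rewrite lerD2r.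
  by rewrite -natrD ler_nat.
move=> /step; rewrite mulD mulnn => h.
have := mulD (k%:R + i%:R - n) n; rewrite subrK mulD mulnn uz.
move: (step _ _ kz) (steplt _ _ ilt) h u1; rewrite mulnn uz.
move: (_ * (_ / n)) (_ * (z / n)) (_ * (i%:R / n)) (_ * (k%:R / n)) => D A B C.
move=> h1 h2 h3 h4 h5.
by case: ltP => *; apply/andP; split; lra.
Qed.

End rotation.

Section mean_lower_bound.
Context {R : realType} {d : measure_display} {T : measurableType d}.
Variable P : probability T R.
Local Notation mu := (@lebesgue_measure R).

(* At [j = 0] the grid point is [a], where [quantile] has the junk value 0 if
   [a = 0]; the threshold [c] replaces it. *)
Definition lower_step (a c : R) (X : T -> R) (n j : nat) : R :=
  if j is 0%N then c else quantile P X (grid a n j).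

Lemma grid_lt1 (a : R) (n j : nat) : a < 1 -> (j < n)%N -> grid a n j < 1.
Proof.
move=> a1 jn; rewrite /grid -ltrBrDl gtr_pMr ?subr_gt0//.
by rewrite ltr_pdivrMr ?mul1r ?ltr_nat// ltr0n (leq_ltn_trans _ jn).
Qed.

Lemma grid_ge (a : R) (n j : nat) : a < 1 -> a <= grid a n j.
Proof. by move=> a1; rewrite /grid lerDl mulr_ge0 ?divr_ge0// subr_ge0 ltW. Qed.

Lemma sum_rotation_ge (a c u : R) (X : T -> R) (N : nat) :
  measurable_fun setT X -> 0 <= a -> threshold P a X c -> a <= u < 1 ->
  \sum_(j < N.+1) lower_step a c X N.+1 j <=
  \sum_(i < N.+1) quantile P X (rotation a ((1 - a) * (i%:R / N.+1%:R)) u).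
Proof.
move=> mX a0 [cq _] u01; have [k kP] := rotation_grid N a0 u01.
have a1 : a < 1 by case/andP: u01 => /le_lt_trans; apply.
(* Translation by [k] permutes the cells, so the lower bound no longer depends on [u]. *)
rewrite (reindex_inj (addrI k)); apply: ler_sum => i _.
have /andP[gr r1] := kP i.
rewrite /lower_step; case E : (nat_of_ord (k + i)%R) gr => [|j] gr.
  apply: cq; rewrite r1 andbT; apply: le_trans gr; exact: grid_ge.
apply: quantile_homo => //; apply: (le_lt_trans a0).
by rewrite /grid ltrDl mulr_gt0 ?subr_gt0// divr_gt0 ?ltr0n.
Qed.

(** The quantile at a grid point dominates the quantile on the cell before it. Moved by one cell,
    the lower sum is thus an upper sum for the integral that stops at the last grid point before 1,
    even if the quantile is unbounded near 1. *)
Lemma step_sum_integral_le (a : R) (X : T -> R) (n k : nat) : L1 P X ->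
  0 <= a < 1 -> (k < n)%N ->
  \int[mu]_(b in `]a, grid a n k]) quantile P X b <=
  (1 - a) / n%:R * \sum_(1 <= j < k.+1) quantile P X (grid a n j).
Proof.
move=> LX /andP[a0 a1]; elim: k => [|k IH] kn.
  by rewrite /grid mul0r mulr0 addr0 big_geq// mulr0
    set_itv_ge ?bnd_simp ?ltxx// Rintegral_set0.
have n0 : 0 < n%:R :> R by rewrite ltr0n (leq_ltn_trans _ kn).
have gridS : grid a n k.+1 - grid a n k = (1 - a) / n%:R.
  by rewrite /grid -natr1; field; rewrite gt_eqF.
have gkk : grid a n k <= grid a n k.+1.
  by rewrite -subr_ge0 gridS divr_ge0 ?ltW// subr_gt0.
rewrite big_nat_recr//= mulrDr.
have := Rintegral_itvB (f := quantile P X) (a := BRight a)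
  (b := BRight (grid a n k.+1)) (x := grid a n k).
move=> /(_ (integrable_quantile_sub _ LX)).
rewrite !bnd_simp (grid_ge _ _ a1) => /(_ (measurable_itv _) isT gkk) E.
rewrite -[leLHS](subrK (\int[mu]_(b in `]a, grid a n k]) quantile P X b)).
rewrite addrC lerD ?IH ?(ltnW kn)// E.
apply: (@le_trans _ _ (\int[mu]_(b in `]grid a n k, grid a n k.+1])
  quantile P X (grid a n k.+1))).
  apply: le_Rintegral => //.
  - exact: integrable_quantile_sub.
  - apply: integrable_cst_lty => //.
    exact: lebesgue_itv_lty.
  - move=> b /=; rewrite in_itv/= => /andP[kb bk].
    apply: quantile_homo => //; first exact: LX.1.
      by apply: le_lt_trans kb; apply: le_trans (grid_ge _ _ a1).
    exact: grid_lt1.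
rewrite Rintegral_cst//= lebesgue_measure_itv/= lte_fin.
case: ifPn => [_|]; first by rewrite -EFinB/= gridS mulrC.
rewrite -leNgt => kk; have : (1 - a) / n%:R <= 0 by rewrite -gridS subr_le0.
by rewrite leNgt divr_gt0 ?subr_gt0.
Qed.

Lemma tail_integral_lim (a c r : R) (X : T -> R) : L1 P X -> 0 <= a < 1 ->
  (forall N, (\sum_(j < N.+1) lower_step a c X N.+1 j) / N.+1%:R <= r) ->
  tail_integral P a X <= (1 - a) * r.
Proof.
move=> LX a01 Sr; have /andP[a0 a1] := a01.
pose I x := parameterized_integral mu a x (quantile P X).
have IE (x : R) : \int[mu]_(b in `]a, x]) quantile P X b = I x.
  by rewrite /I /parameterized_integral Rintegral_itv_obnd_cbnd//;
    exact: integrable_quantile_sub.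
have tE : tail_integral P a X = I 1.
  rewrite -IE /tail_integral Rintegral_itv_bndo_bndc//.
  exact: integrable_quantile_sub.
(* The first cell contributes [c] times its length, which tends to 0. The integral lacks the last
   cell, which is recovered from continuity in the upper limit. *)
have bound N :
    (1 - a) * c * harmonic N + I (1 - (1 - a) * harmonic N) <= (1 - a) * r.
  have gE : grid a N.+1 N = 1 - (1 - a) * harmonic N.
    rewrite /grid /harmonic/= -[N%:R](addrK 1) natr1.
    have : N.+1%:R != 0 :> R by rewrite pnatr_eq0.
    by move: (N.+1%:R : R) => n n0; field.
  have := step_sum_integral_le LX a01 (ltnSn N); rewrite gE IE => Ile.
  rewrite (le_trans (lerD (lexx _) Ile))// /harmonic/=.
  rewrite [leLHS](_ : _ = (1 - a) *
    ((\sum_(j < N.+1) lower_step a c X N.+1 j) / N.+1%:R)).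
    by rewrite ler_wpM2l// subr_ge0 ltW.
  rewrite big_ord_recl/= big_add1/= big_mkord.
  have : N.+1%:R != 0 :> R by rewrite pnatr_eq0.
  by move: (N.+1%:R : R) => n n0; field.
rewrite tE.
have harm0 := @cvg_harmonic R.
have cvgI : I (1 - (1 - a) * harmonic N) @[N --> \oo] --> I 1.
  have := parameterized_integral_cvg_at_left a1
    (integrable_quantile_sub (measurable_itv `[a, 1]) LX).
  move=> /cvg_at_leftP; apply; split.
    by move=> n; rewrite ltrBlDr ltrDl mulr_gt0 ?subr_gt0// /harmonic/= invr_gt0.
  have : 1 - (1 - a) * harmonic N @[N --> \oo] --> 1 - (1 - a) * 0.
    by apply: cvgB; [exact: cvg_cst | apply: cvgM => //; exact: cvg_cst].
  by rewrite mulr0 subr0.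
have h : (1 - a) * c * harmonic N + I (1 - (1 - a) * harmonic N) @[N --> \oo]
    --> I 1.
  rewrite -[X in _ --> X]add0r -(mulr0 ((1 - a) * c)).
  by apply: cvgD => //; apply: cvgM => //; exact: cvg_cst.
by apply: (closed_cvg _ (@closed_le _ ((1 - a) * r)) _ _ h) => //; exact: nearW.
Qed.

End mean_lower_bound.

(** * Minimality *)

Section minimality.
Context {R : realType} {d : measure_display} {T : measurableType d}.
Variable P : probability T R.
Local Notation mu := (@lebesgue_measure R).

(** For [x < m] the event [Z w <= x] lies inside [U w < a], whose mass is exactly [a]; the strict
    inequality in [VaRp] excludes such [x]. *)
Lemma VaRp_ge (a m : R) (U Z : T -> R) : is_uniform P U -> 0 <= a <= 1 ->
  measurable_fun setT Z -> (forall w, a <= U w -> m <= Z w) ->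
  (m%:E <= VaRp P a Z)%E.
Proof.
move=> unifU a01 mZ mle; apply: le_ereal_inf_tmp => _ [x /= ax <-].
rewrite lee_fin leNgt; apply/negP => xm; move: ax; rewrite ltNge => /negP; apply.
rewrite -(uniform_lt unifU a01) le_measure ?inE//.
- exact: measurable_le_set.
- exact: measurable_lt_set unifU.1 _.
- move=> w /= Zx; rewrite ltNge; apply/negP => /mle; rewrite leNgt.
  by rewrite (le_lt_trans Zx).
Qed.

Lemma VaR_le_VaRp (a : R) (X : T -> R) : (VaR P a X <= VaRp P a X)%E.
Proof. by apply: le_ereal_inf => _ [x /= ax <-]; exists x => //=; exact: ltW. Qed.

Lemma VaRp_le_VaR (a b : R) (X : T -> R) : a < b -> (VaRp P a X <= VaR P b X)%E.
Proof.
move=> ab; apply: le_ereal_inf => _ [x /= ax <-]; exists x => //=.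
by apply: lt_le_trans ax; rewrite lte_fin.
Qed.

Lemma VaR_same_law (a : R) (X Y : T -> R) : same_law P X Y ->
  VaR P a X = VaR P a Y.
Proof.
move=> XY; rewrite /VaR; congr (ereal_inf (EFin @` _)).
by apply/funext => x /=; have := XY _ (measurable_itv `]-oo, x]) => <-.
Qed.

Lemma ES_same_law (a : R) (X Y : T -> R) : same_law P X Y -> ES P a X = ES P a Y.
Proof.
move=> XY; rewrite /ES; case: ifP => _; last exact: VaR_same_law.
by under eq_integral do rewrite (VaR_same_law _ XY).
Qed.

Lemma VaRp_le_ES (a : R) (X : T -> R) : 0 <= a < 1 -> L1 P X ->
  (VaRp P a X <= ES P a X)%E.
Proof.
move=> a01 LX; have /andP[a0 a1] := a01; rewrite ES_tail_integral//.
have vq b : a < b < 1 -> (VaRp P a X <= (quantile P X b)%:E)%E.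
  move=> /andP[ab b1]; rewrite -VaR_quantile//; last by rewrite b1 (le_lt_trans a0).
    exact: VaRp_le_VaR.
  exact: LX.1.
(* One real upper bound, at the midpoint of [a] and 1, excludes the value [+oo]; the value [-oo] is
   possible for [a = 0]. *)
have : (VaRp P a X <= (quantile P X ((a + 1) / 2))%:E)%E by apply: vq; lra.
case E : (VaRp P a X) => [v||] h; rewrite ?leNye//.
rewrite lee_fin mulrC ler_pdivlMr ?subr_gt0//.
have -> : v * (1 - a) = \int[mu]_(b in `]a, 1[) v.
  by rewrite Rintegral_cst//= lebesgue_measure_itv/= lte_fin a1 -EFinB.
apply: le_Rintegral => //.
- by apply: integrable_cst_lty => //; exact: lebesgue_itv_lty.
- exact: integrable_quantile_sub.
- by move=> b /=; rewrite in_itv/= => /vq; rewrite E lee_fin.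
Qed.

Definition convex_domain (D : set (T -> R)) :=
  forall X Y, D X -> D Y -> forall g : R, 0 <= g <= 1 ->
    D (fun w => g * X w + (1 - g) * Y w).

(** Places the rearranged copies of a variable in the domain, where law invariance can compare them
    with it. *)
Definition law_closed (D : set (T -> R)) :=
  forall X Y, D X -> measurable_fun setT Y -> same_law P Y X -> D Y.

Definition mean (Xs : nat -> T -> R) (n : nat) (w : T) : R :=
  (\sum_(i < n.+1) Xs i w) / n.+1%:R.

(** Membership in [D] is carried through the induction because quasi-convexity applies only inside
    the domain. *)
Lemma quasi_convex_mean (D : set (T -> R)) (rho : (T -> R) -> \bar R)
    (Xs : nat -> T -> R) (r : \bar R) (n : nat) :
  convex_domain D -> quasi_convex_on D rho ->
  (forall i, (i <= n)%N -> D (Xs i) /\ (rho (Xs i) <= r)%E) ->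
  D (mean Xs n) /\ (rho (mean Xs n) <= r)%E.
Proof.
move=> Dc qc; elim: n => [|n IH] DX.
  have -> : mean Xs 0 = Xs 0%N.
    by apply/funext => w; rewrite /mean big_ord1 divr1.
  exact: DX.
have [Dm rm] := IH (fun i ni => DX i (leqW ni)).
have [DXn rXn] := DX n.+1 (leqnn _).
pose g : R := n.+1%:R / n.+2%:R.
have g01 : 0 <= g <= 1.
  by rewrite divr_ge0//= ler_pdivrMr ?mul1r ?ler_nat// ltr0n.
have -> : mean Xs n.+1 = (fun w => g * mean Xs n w + (1 - g) * Xs n.+1 w).
  apply/funext => w; rewrite /mean /g big_ord_recr/=.
  have n0 : n.+1%:R != 0 :> R by rewrite pnatr_eq0.
  have n1 : n.+2%:R != 0 :> R by rewrite pnatr_eq0.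
  have nE : n.+1%:R = n.+2%:R - 1 :> R by rewrite -[n.+2%:R]natr1 addrK.
  move: (\sum_(i < n.+1) _) (Xs n.+1 w) n0 n1; rewrite nE.
  move: (n.+2%:R : R) => N S x n0 n1; field; rewrite n1//.
split; first exact: Dc.
by apply: le_trans (qc _ _ Dm DXn g g01) _; rewrite ge_max rm rXn.
Qed.

Lemma ES_quasi_convex (a : R) (D : set (T -> R)) : 0 <= a < 1 ->
  D `<=` L1 P -> (forall X, D X -> exists c, threshold P a X c) ->
  quasi_convex_on D (ES P a).
Proof.
move=> a01 DL Dt X Y DX DY g g01.
have [c1 t1] := Dt _ DX; have [c2 t2] := Dt _ DY.
have LX := DL _ DX; have LY := DL _ DY.
apply: le_trans (ES_convex a01 g01 LX LY t1 t2) _.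
rewrite !ES_tail_integral// -!EFinM -EFinD -EFin_max lee_fin.
move: (_^-1 * _) (_^-1 * _) => y x; have /andP[g0 g1] := g01.
have xM : x <= Num.max x y by rewrite le_max lexx.
have yM : y <= Num.max x y by rewrite le_max lexx orbT.
have g1' : 0 <= 1 - g by rewrite subr_ge0.
apply: le_trans (lerD (ler_wpM2l g0 xM) (ler_wpM2l g1' yM)) _.
by rewrite -mulrDl subrKC mul1r.
Qed.

Lemma ES_admissible (a : R) (D : set (T -> R)) : 0 <= a < 1 ->
  D `<=` L1 P -> (forall X, D X -> exists c, threshold P a X c) ->
  admissible P D (VaRp P a) (ES P a).
Proof.
move=> a01 DL Dt; split.
- by move=> X /DL LX; exact: VaRp_le_ES.
- exact: ES_quasi_convex.
- by move=> X Y _ _; exact: ES_same_law.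
Qed.

Lemma ES_minimal (a : R) (D : set (T -> R)) (rho : (T -> R) -> \bar R) :
  atomless P -> 0 <= a < 1 -> D `<=` L1 P -> convex_domain D -> law_closed D ->
  (forall X, D X -> exists c, threshold P a X c) ->
  admissible P D (VaRp P a) rho -> forall X, D X -> (ES P a X <= rho X)%E.
Proof.
move=> atomlessP a01 DL Dc Dl Dt [dom qc li] X DX; have /andP[a0 a1] := a01.
have LX := DL _ DX; have mX := LX.1; have [c tc] := Dt _ DX.
have [U [unifU U01]] := atomless_uniform atomlessP.
pose s N (i : nat) : R := (1 - a) * (i%:R / N.+1%:R).
pose Xs N i := quantile P X \o (rotation a (s N i) \o U).
have XsP N i : (i <= N)%N -> D (Xs N i) /\ (rho (Xs N i) <= rho X)%E.
  move=> iN; have unif_rot : is_uniform P (rotation a (s N i) \o U).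
    apply: uniform_rotation => //; rewrite /s mulr_ge0 ?subr_ge0 ?(ltW a1)//=.
    by rewrite gtr_pMr ?subr_gt0// ltr_pdivrMr ?mul1r ?ltr_nat// ltr0n.
  have law : same_law P (Xs N i) X by exact: quantile_uniform_law.
  have DXs : D (Xs N i).
    apply: Dl law => //; apply: measurableT_comp; last exact: unif_rot.1.
    exact: measurable_quantile.
  by split => //; rewrite (li _ _ DXs DX law).
have lower N :
    (((\sum_(j < N.+1) lower_step P a c X N.+1 j) / N.+1%:R)%:E <= rho X)%E.
  have [Dm rm] := quasi_convex_mean Dc qc (XsP N).
  apply: le_trans rm; apply: le_trans (dom _ Dm).
  apply: (VaRp_ge unifU) => //; first by rewrite a0 ltW.
    exact: (DL _ Dm).1.
  move=> w aU; rewrite /mean ler_wpM2r ?invr_ge0//.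
  by apply: sum_rotation_ge => //; rewrite aU; case/andP: (U01 w).
rewrite ES_tail_integral//.
(* The value [-oo] is ruled out by the real lower bound at [N = 0]. *)
case E : (rho X) lower => [r||] lower; rewrite ?leey//; last first.
  by have := lower 0%N; rewrite leeNy_eq.
rewrite lee_fin ler_pdivrMl ?subr_gt0//.
by apply: (tail_integral_lim (c := c)) => // N; have := lower N; rewrite lee_fin.
Qed.

(** At level 1 the value at risk is the essential supremum: off two null sets both variables, hence
    their mixture, stay below the larger bound. *)
Lemma VaR1_quasi_convex (D : set (T -> R)) :
  (forall X, D X -> measurable_fun setT X) -> quasi_convex_on D (VaR P 1).
Proof.
move=> DL X Y /DL mX /DL mY g /andP[g0 g1].
set Z := (fun w => _).
have mZ : measurable_fun setT Z.
  by apply: measurable_funD; exact: measurable_funM.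
have null (V : T -> R) (v : R) : measurable_fun setT V ->
    (1 <= P [set w | (V w <= v)%R])%E ->
    P (~` [set w | V w <= v]) = 0%E.
  move=> mV v1; have mv := measurable_le_set mV v.
  apply: (etrans (probability_setC P mv)).
  have -> : P [set w | V w <= v] = 1%E.
    by apply/eqP; rewrite eq_le v1 probability_le1.
  by rewrite subee.
rewrite leNgt gt_max; apply/negP => /andP[].
move=> /ereal_inf_lt[_ [x /= x1 <-] xZ] /ereal_inf_lt[_ [y /= y1 <-] yZ].
have mx := measurable_le_set mX x; have my := measurable_le_set mY y.
have mz := measurable_le_set mZ (Num.max x y).
suff /ereal_inf_lbound : [set z%:E | z in
    [set z : R | (1%:E <= P [set w | (Z w <= z)%R])%E]] (Num.max x y)%:E.
  by rewrite leNgt; case: (leP x y) => _; rewrite ?xZ ?yZ.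
exists (Num.max x y) => //=.
have Z0 : P (~` [set w | Z w <= Num.max x y]) = 0%E.
  apply: (@subset_measure0 _ _ _ P _
    (~` [set w | X w <= x] `|` ~` [set w | Y w <= y])).
  - exact: measurableC.
  - by apply: measurableU; exact: measurableC.
  - rewrite -setCI; apply: subsetC => w /= [Xx Yy].
    have {}Xx : X w <= Num.max x y by rewrite le_max Xx.
    have {}Yy : Y w <= Num.max x y by rewrite le_max Yy orbT.
    have g1' : 0 <= 1 - g by rewrite subr_ge0.
    apply: le_trans (lerD (ler_wpM2l g0 Xx) (ler_wpM2l g1' Yy)) _.
    by rewrite -mulrDl subrKC mul1r.
  - apply: (etrans (measureU0 _ _ _)); try exact: measurableC.
      exact: null.
    exact: null.
have := probability_setC P (measurableC mz); rewrite setCK => ZE.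
by rewrite [leRHS]ZE [X in (_ - X)%E]Z0 sube0.
Qed.

Lemma ES_le_of_lt (a : R) (X : T -> R) (r : \bar R) : 0 < a < 1 -> L1 P X ->
  (forall b, 0 < b < a -> (ES P b X <= r)%E) -> (ES P a X <= r)%E.
Proof.
move=> /andP[a0 a1] LX br.
have ES_real b : 0 <= b < 1 -> ES P b X = ((1 - b)^-1 * tail_integral P b X)%:E.
  by move=> b01; exact: ES_tail_integral.
case: r br => [r||] br; rewrite ?leey//; last first.
  have := br (a / 2) ltac:(lra); rewrite ES_real; last by lra.
  by rewrite leeNy_eq.
rewrite ES_real; last by rewrite ltW.
rewrite lee_fin ler_pdivrMl ?subr_gt0//.
(* Lower bound of the quantiles on [[a / 2, a]], uniform in [b]; near level 0 they may be unbounded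
   below. *)
pose k := quantile P X (a / 2).
have step b : a / 2 <= b -> b < a ->
    (a - b) * k + tail_integral P a X <= (1 - b) * r.
  move=> b1 b2; have b0 : 0 < b by lra.
  have := br b; rewrite b0 b2 => /(_ isT); rewrite ES_real; last by lra.
  rewrite lee_fin ler_pdivrMl; last by lra.
  apply: le_trans; rewrite /tail_integral.
  have := Rintegral_itvB (f := quantile P X) (a := BRight b)
    (b := BLeft 1) (x := a).
  move=> /(_ (integrable_quantile_sub (measurable_itv _) LX)).
  rewrite !bnd_simp (ltW b2) => /(_ isT a1) <-.
  rewrite addrCA gerDl subr_le0.
  have -> : (a - b) * k = \int[mu]_(x in `]b, a]) k.
    rewrite Rintegral_cst//= lebesgue_measure_itv/= lte_fin b2 -EFinB/=.
    by rewrite mulrC.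
  apply: le_Rintegral => //.
  - by apply: integrable_cst_lty => //; exact: lebesgue_itv_lty.
  - exact: integrable_quantile_sub.
  - move=> x /=; rewrite in_itv/= => /andP[bx xa].
    apply: quantile_homo; [exact: LX.1 | lra | lra | lra].
apply/ler_addgt0Pr => e e0.
(* By [step], the tail integral at [a] is at most (1 - a) r + (a - b)(r - k); [M] bounds |r - k|,
   and the summand 1 keeps it positive. The maximum in [b] keeps it where [step] applies. *)
pose M := `|k| + `|r| + 1; have M0 : 0 < M by rewrite ltr_wpDl ?addr_ge0.
pose b := Num.max (a / 2) (a - e / M).
have eM : 0 < e / M by rewrite divr_gt0.
have ba : b < a by rewrite /b gt_max; lra.
have := step b; rewrite /b le_max lexx => /(_ isT); rewrite -/b => /(_ ba) h.
have abM : (a - b) * M <= e.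
  by rewrite -ler_pdivlMr// lerBlDl -lerBlDr /b le_max lexx orbT.
have ab0 : 0 <= a - b by lra.
have kk : - ((a - b) * `|k|) <= (a - b) * k.
  by rewrite -mulrN ler_wpM2l// lerNl -normrN ler_norm.
have rr : (a - b) * r <= (a - b) * `|r| by rewrite ler_wpM2l// ler_norm.
have ME : (a - b) * M = (a - b) * `|k| + (a - b) * `|r| + (a - b).
  by rewrite /M; ring.
have rE : (1 - b) * r = (1 - a) * r + (a - b) * r by ring.
move: h abM kk rr ab0; rewrite ME rE.
move: (_ * k) (_ * `|k|) (_ * `|r|) ((a - b) * r) (_ * r) => ? ? ? ? ? *.
lra.
Qed.

Lemma threshold_quantile (a : R) (X : T -> R) : 0 < a < 1 ->
  measurable_fun setT X -> threshold P a X (quantile P X a).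
Proof.
move=> /andP[a0 a1] mX; split => b /andP[b1 b2].
  exact: quantile_homo.
by apply: quantile_homo.
Qed.

Lemma threshold_bounded_below (X : T -> R) : L1b P X ->
  exists c, threshold P 0 X c.
Proof.
(* The minimum with 0 accommodates the junk value [quantile P X 0 = 0]. *)
move=> [[mX _] [c Xc]]; exists (Num.min c 0); split => b; last first.
  by move=> /andP[b0 /(lt_le_trans b0)]; rewrite ltxx.
move=> /andP[b0 b1].
have [->|bn0] := eqVneq b 0.
  by rewrite /quantile patchE memNset ?ge_min ?lexx ?orbT//= in_itv/= ltxx.
have {}b0 : 0 < b by rewrite lt_neqAle eq_sym bn0.
rewrite ge_min; apply/orP; left; rewrite leNgt; apply/negP => qc.
have : b <= prob_le P X (quantile P X b) by rewrite -quantile_le ?b0.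
rewrite leNgt => /negP; apply; apply: le_lt_trans b0.
rewrite -lee_fin -prob_leE// -[leRHS]Xc le_measure ?inE//.
- exact: measurable_le_set.
- exact: measurable_lt_set.
- by move=> w /= /le_lt_trans; apply.
Qed.

Lemma L1_law_closed : law_closed (L1 P).
Proof.
move=> X Y [mX /integrableP[_ iX]] mY YX; split => //; apply/integrableP; split.
  exact/measurable_EFinP.
rewrite (ge0_integral_same_law mX mY YX (g := fun x => `|x%:E|%E))//.
by apply/measurable_EFinP; exact: normr_measurable.
Qed.

Lemma L1b_law_closed : law_closed (L1b P).
Proof.
move=> X Y [LX [c Xc]] mY YX; split; first exact: L1_law_closed LX mY YX.
by exists c; have := YX _ (measurable_itv `]-oo, c[) => h; apply: (etrans h).
Qed.

Lemma L1b_convex : convex_domain (L1b P).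
Proof.
move=> X Y [LX [c1 Xc]] [LY [c2 Yc]] g /andP[g0 g1]; split.
  exact: L1_convex.
have mX := measurable_lt_set LX.1 c1; have mY := measurable_lt_set LY.1 c2.
exists (g * c1 + (1 - g) * c2).
apply: (@subset_measure0 _ _ _ P _ ([set w | X w < c1] `|` [set w | Y w < c2])).
- exact: measurable_lt_set (L1_convex g LX LY).1 _.
- exact: measurableU.
- move=> w /=; case: (ltP (X w) c1); first by left.
  case: (ltP (Y w) c2); first by right.
  move=> cY cX; rewrite ltNge lerD// ler_wpM2l// subr_ge0//.
- exact: etrans (measureU0 mX mY Yc) Xc.
Qed.

End minimality.

Theorem theorem5 (R : realType) (d : measure_display) (T : measurableType d)
  (P : probability T R) :
  atomless P ->
  (forall a : R, 0 < a <= 1 ->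
     is_min_admissible P (L1 P) (VaR P a) (ES P a)) /\
  (forall a : R, 0 < a < 1 ->
     is_min_admissible P (L1 P) (VaRp P a) (ES P a)) /\
  (forall a : R, 0 <= a < 1 ->
     is_min_admissible P (L1b P) (VaRp P a) (ES P a)).
Proof.
move=> atomlessP.
have L1t a : 0 < a < 1 -> forall X, L1 P X -> exists c, threshold P a X c.
  by move=> a01 X [mX _]; exists (quantile P X a); exact: threshold_quantile.
have minL1 a : 0 < a < 1 -> is_min_admissible P (L1 P) (VaRp P a) (ES P a).
  move=> /[dup] a01 /andP[a0 a1]; have a01' : 0 <= a < 1 by rewrite ltW.
  split; first exact: (ES_admissible a01' _ (L1t _ a01)).
  move=> rho; apply: (ES_minimal atomlessP a01' _ _ _ (L1t _ a01)) => //.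
    by move=> X Y LX LY g _; exact: L1_convex.
  exact: L1_law_closed.
split; last split => // a a01.
- move=> a /andP[a0]; rewrite le_eqVlt => /predU1P[->|a1].
    (* At level 1 the candidate is the dominated functional itself, so minimality is the domination
       hypothesis. *)
    have ->: ES P 1 = VaR P 1 by apply/funext => X; rewrite /ES ltxx.
    split; last by move=> rho [dom _ _].
    split => //; first by apply: VaR1_quasi_convex => X [].
    by move=> X Y _ _; exact: VaR_same_law.
  have a01 : 0 < a < 1 by rewrite a0.
  have [[dom qc li] _] := minL1 a a01; split.
    by split => // X LX; exact: le_trans (VaR_le_VaRp _ _ _) (dom _ LX).
  move=> rho [domr qcr lir] X LX; apply: ES_le_of_lt => //.
  move=> b /andP[b0 ba]; have b01 : 0 < b < 1 by rewrite b0 (lt_trans ba).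
  have [_ minb] := minL1 b b01; apply: minb => //; split => // Y LY.
  exact: le_trans (VaRp_le_VaR P Y ba) (domr _ LY).
- have Lt X : L1b P X -> exists c, threshold P a X c.
    move=> LX; have /andP[] := a01; rewrite le_eqVlt => /predU1P[<-|a0] a1.
      exact: threshold_bounded_below.
    by apply: L1t; [rewrite a0 | exact: LX.1].
  have LL : L1b P `<=` L1 P by move=> X [].
  split; first exact: ES_admissible.
  move=> rho; apply: (ES_minimal atomlessP a01 LL _ _ Lt).
    exact: L1b_convex.
  exact: L1b_law_closed.
Qed.
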